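(* Let $\mathcal{H}$ be a real separable Hilbert space, let $\{e_n : n\in\mathbb{N}\}\subset\mathcal{H}$ be an orthonormal basis of $\mathcal{H}$, and let $A\in\mathcal{L}(\mathcal{H})$. Then the following statements are equivalent: (i) The system $\{\tfrac{1}{\sqrt2}(e_n+iAe_n) : n\in\mathbb{N}\}$ is an orthonormal basis of the complex Hilbert space $\mathcal{H}+i\mathcal{H}$. (ii) $A:\mathcal{H}\to\mathcal{H}$ is self-adjoint and unitary. In this case $A=A^*=A^{-1}$.
   Context: $\mathcal{H}+i\mathcal{H}$ is the complexification of the real Hilbert space $\mathcal{H}$: the complex Hilbert space of all $f_r+if_i$ with $f_r,f_i\in\mathcal{H}$ and inner product $\langle f_r+if_i,g_r+ig_i\rangle=\langle f_r,g_r\rangle_{\mathcal{H}}+\langle f_i,g_i\rangle_{\mathcal{H}}+i(\langle f_i,g_r\rangle_{\mathcal{H}}-\langle f_r,g_i\rangle_{\mathcal{H}})$. $\mathcal{L}(\mathcal{H})$ is the space of bounded linear operators $\mathcal{H}\to\mathcal{H}$. An operator $A$ on a real Hilbert space is called unitary if $A^*A=AA^*=\mathrm{Id}$. *)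

(* Defs.v *)
From HB Require Import structures.
From mathcomp Require Import all_boot all_order all_algebra.
From mathcomp Require Import all_classical all_reals all_analysis.
From mathcomp Require Import complex ring lra.

Set Implicit Arguments.
Unset Strict Implicit.
Unset Printing Implicit Defensive.

Import Order.TTheory GRing.Theory Num.Theory.
Import numFieldNormedType.Exports.

Local Open Scope classical_set_scope.
Local Open Scope complex_scope.
Local Open Scope ring_scope.

(* theta is the conjugation of the scalars: idfun over R, conjc over R[i].  A
   form of type {dot H for theta} is linear in its first argument. *)
HB.mixin Record isHilbert (K : numFieldType) (theta : K -> K) H
    & CompleteNormedModule K H := {
  inner : {dot H for theta} ;
  sqr_norm_inner : forall x : H, `|x| ^+ 2 = inner x x }.

#[short(type="hilbertType")]
HB.structure Definition Hilbert (K : numFieldType) (theta : K -> K) :=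
  {H of CompleteNormedModule K H & isHilbert K theta H}.

Notation realHilbertType R := (hilbertType (@idfun R)).
Notation complexHilbertType R := (hilbertType (@conjc R)).

Definition orthonormal_basis (K : numFieldType) (theta : K -> K)
    (H : hilbertType theta) (u : nat -> H) : Prop :=
  (forall m n, inner (u m) (u n) = (m == n)%:R) /\
  dense [set x | exists (n : nat) (c : nat -> K), x = \sum_(i < n) c i *: u i].

Definition separable (T : topologicalType) : Prop :=
  exists2 S : set T, countable S & dense S.

Definition bounded_operator (K : numFieldType) (H : normedModType K)
    (A : H -> H) : Prop :=
  exists M : K, forall x, `|A x| <= M * `|x|.

(* A^* y is the vector representing x |-> <A x, y>; adjointP shows that it
   exists when A is linear and bounded on a real Hilbert space. *)
Definition adjoint (K : numFieldType) (theta : K -> K) (H : hilbertType theta)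
    (A : H -> H) (y : H) : H :=
  get [set z | forall x, inner (A x) y = inner x z].

Definition self_adjoint (K : numFieldType) (theta : K -> K)
    (H : hilbertType theta) (A : H -> H) : Prop :=
  adjoint A = A.

Definition inverse_of (T : Type) (A B : T -> T) : Prop :=
  B \o A = id /\ A \o B = id.

Definition unitary (K : numFieldType) (theta : K -> K)
    (H : hilbertType theta) (A : H -> H) : Prop :=
  adjoint A \o A = id /\ A \o adjoint A = id.

Section RealInner.
Variables (R : realType) (H : realHilbertType R).
Implicit Types x y z : H.

Lemma innerC x y : inner x y = inner y x.
Proof. by rewrite hermC expr0 mul1r. Qed.

Lemma innerZl a x y : inner (a *: x) y = a * inner x y.
Proof. by rewrite linearZl. Qed.

Lemma innerZr a x y : inner x (a *: y) = a * inner x y.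
Proof. by rewrite linearZr. Qed.

Lemma norm_sqrt_inner x : `|x| = Num.sqrt (inner x x).
Proof. by rewrite -sqr_norm_inner sqrtr_sqr normr_id. Qed.

Lemma inner_ge0 x : 0 <= inner x x.
Proof. by rewrite -sqr_norm_inner sqr_ge0. Qed.

Lemma sqr_normD x y : `|x + y| ^+ 2 = `|x| ^+ 2 + `|y| ^+ 2 + 2 * inner x y.
Proof.
rewrite !sqr_norm_inner linearDl !linearDr /= (innerC y x); ring.
Qed.

Lemma sqr_normB x y : `|x - y| ^+ 2 = `|x| ^+ 2 + `|y| ^+ 2 - 2 * inner x y.
Proof. by rewrite sqr_normD normrN linearNr mulrN. Qed.

Lemma parallelogram x y :
  `|x + y| ^+ 2 + `|x - y| ^+ 2 = 2 * (`|x| ^+ 2 + `|y| ^+ 2).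
Proof. rewrite sqr_normD sqr_normB; ring. Qed.

End RealInner.

(* Cplx f g is f + i g (CplxE). *)
Record complexification (R : realType) (H : realHilbertType R) :=
  Cplx { re_part : H ; im_part : H }.

Section ComplexificationAlgebra.
Variables (R : realType) (H : realHilbertType R).
Local Notation HC := (complexification H).
Implicit Types (f g h : HC) (z w : R[i]).

Definition pair_of_cplx f := (re_part f, im_part f).
Definition cplx_of_pair (p : H * H) : HC := Cplx p.1 p.2.

Lemma pair_of_cplxK : cancel pair_of_cplx cplx_of_pair.
Proof. by case. Qed.

HB.instance Definition _ := Choice.copy HC (can_type pair_of_cplxK).

Definition cplx_zero : HC := Cplx 0 0.
Definition cplx_opp f : HC := Cplx (- re_part f) (- im_part f).
Definition cplx_add f g : HC :=
  Cplx (re_part f + re_part g) (im_part f + im_part g).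

Lemma cplx_addA : associative cplx_add.
Proof. by move=> [a b] [c d] [e f]; rewrite /cplx_add /= !addrA. Qed.
Lemma cplx_addC : commutative cplx_add.
Proof. by move=> [a b] [c d]; congr Cplx => /=; rewrite addrC. Qed.
Lemma cplx_add0 : left_id cplx_zero cplx_add.
Proof. by move=> [a b]; rewrite /cplx_add /= !add0r. Qed.
Lemma cplx_addN : left_inverse cplx_zero cplx_opp cplx_add.
Proof. by move=> [a b]; rewrite /cplx_add /= !addNr. Qed.

HB.instance Definition _ :=
  GRing.isZmodule.Build HC cplx_addA cplx_addC cplx_add0 cplx_addN.

Definition cplx_scale z f : HC :=
  Cplx (complex.Re z *: re_part f - complex.Im z *: im_part f)
       (complex.Re z *: im_part f + complex.Im z *: re_part f).

Lemma cplx_scaleA z w f :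
  cplx_scale z (cplx_scale w f) = cplx_scale (z * w) f.
Proof.
case: z w f => [a b] [c d] [f g]; rewrite /cplx_scale /=; congr Cplx;
  rewrite !scalerDr !scalerDl ?scalerN ?scaleNr !scalerA ?opprD ?opprK;
  by rewrite [LHS](AC (2*2) ((1*4)*(2*3))).
Qed.

Lemma cplx_scale1 : left_id 1 cplx_scale.
Proof.
by case=> a b; rewrite /cplx_scale /= !scale1r !scale0r subr0 addr0.
Qed.

Lemma cplx_scaleDr : right_distributive cplx_scale +%R.
Proof.
move=> [a b] [f g] [h k]; rewrite /cplx_scale /=; congr Cplx => /=;
  rewrite !scalerDr ?opprD; exact: addrACA.
Qed.

Lemma cplx_scaleDl f : {morph cplx_scale^~ f : z w / z + w}.
Proof.
move: f => [f g] [a b] [c d]; rewrite /cplx_scale /=; congr Cplx => /=;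
  rewrite !scalerDl ?opprD; exact: addrACA.
Qed.

HB.instance Definition _ := GRing.Zmodule_isLmodule.Build R[i] HC
  cplx_scaleA cplx_scale1 cplx_scaleDr cplx_scaleDl.

Lemma CplxE (a b : H) : Cplx a b = Cplx a 0 + 'i *: Cplx b 0 :> HC.
Proof.
rewrite /GRing.scale /= /cplx_scale /= !scale0r scaler0 scale1r subr0 add0r.
by rewrite /Algebra.add /= /cplx_add /= addr0 add0r.
Qed.

Definition cplx_norm f : R := Num.sqrt (`|re_part f| ^+ 2 + `|im_part f| ^+ 2).

Lemma cplx_norm_ge0 f : 0 <= cplx_norm f.
Proof. exact: sqrtr_ge0. Qed.

Lemma sqr_cplx_norm f :
  cplx_norm f ^+ 2 = `|re_part f| ^+ 2 + `|im_part f| ^+ 2.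
Proof. by rewrite sqr_sqrtr // addr_ge0 ?sqr_ge0. Qed.

Lemma re_part_le f : `|re_part f| <= cplx_norm f.
Proof.
by rewrite -(ler_pXn2r (ltn0Sn 1)) ?nnegrE ?normr_ge0 ?cplx_norm_ge0 //
  sqr_cplx_norm lerDl sqr_ge0.
Qed.

Lemma im_part_le f : `|im_part f| <= cplx_norm f.
Proof.
by rewrite -(ler_pXn2r (ltn0Sn 1)) ?nnegrE ?normr_ge0 ?cplx_norm_ge0 //
  sqr_cplx_norm lerDr sqr_ge0.
Qed.

Lemma cplx_norm_le f : cplx_norm f <= `|re_part f| + `|im_part f|.
Proof.
rewrite -(ler_pXn2r (ltn0Sn 1)) ?nnegrE ?cplx_norm_ge0 ?addr_ge0 //.
by rewrite sqr_cplx_norm sqrrD addrAC lerDl mulrn_wge0 // mulr_ge0.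
Qed.

Lemma cplx_norm_triangle f g : cplx_norm (f + g) <= cplx_norm f + cplx_norm g.
Proof.
have cs (a b c d : R) : 0 <= a -> 0 <= b -> 0 <= c -> 0 <= d ->
    Num.sqrt ((a + c) ^+ 2 + (b + d) ^+ 2) <=
    Num.sqrt (a ^+ 2 + b ^+ 2) + Num.sqrt (c ^+ 2 + d ^+ 2).
  move=> a0 b0 c0 d0.
  have : `|(a +i* b) + (c +i* d)| <= `|a +i* b| + `|c +i* d|.
    exact: ler_normD.
  by rewrite lecE /= => /andP[].
apply: le_trans (cs _ _ _ _ _ _ _ _) => //.
rewrite ler_wsqrtr // lerD // lerXn2r ?nnegrE ?addr_ge0 //; exact: ler_normD.
Qed.

Lemma cplx_normZ z f : (cplx_norm (z *: f))%:C = `|z| * (cplx_norm f)%:C.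
Proof.
case: z f => [a b] [f g].
have -> : `|a +i* b| = (Num.sqrt (a ^+ 2 + b ^+ 2))%:C by [].
rewrite -rmorphM; congr (_%:C).
rewrite /cplx_norm /= -sqrtrM ?addr_ge0 ?sqr_ge0 //; congr Num.sqrt.
rewrite sqr_normB sqr_normD !normrZ !exprMn !real_normK ?num_real //.
rewrite !(innerZl, innerZr) (innerC g f); ring.
Qed.

Lemma cplx_norm_eq0 f : cplx_norm f = 0 -> f = 0.
Proof.
move=> f0; have := re_part_le f; have := im_part_le f.
by rewrite f0 !normr_le0; case: f f0 => f g /= _ /eqP -> /eqP ->.
Qed.

Definition cplx_normC f : R[i] := (cplx_norm f)%:C.

Lemma cplx_normC_triangle f g :
  cplx_normC (f + g) <= cplx_normC f + cplx_normC g.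
Proof. by rewrite -rmorphD lecR cplx_norm_triangle. Qed.

Lemma cplx_normC_eq0 f : cplx_normC f = 0 -> f = 0.
Proof. by move=> /complexI /cplx_norm_eq0. Qed.

(* The norm of a normed module over R[i] takes its values in R[i]. *)
HB.instance Definition _ := Lmodule_isNormed.Build R[i] HC
  cplx_normC_triangle cplx_normZ cplx_normC_eq0.

Lemma cplx_normE f : `|f| = (cplx_norm f)%:C.
Proof. by []. Qed.

Lemma cplx_complete (F : set_system HC) :
  ProperFilter F -> cauchy F -> cvg F.
Proof.
move=> FF /cauchyP Fc.
have comp (p : HC -> H) : {morph p : f g / f - g} ->
    (forall f, `|p f| <= cplx_norm f) -> cvg (p @ F).
  move=> pB ple; apply: cauchy_cvg; apply/cauchyP => e e0.
  have [|f Ff] := Fc e%:C; first by rewrite ltcR.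
  exists (p f); rewrite -[(p @ F) _]/(F (p @^-1` _)); apply: filterS Ff => g fg.
  rewrite /= -ball_normE /ball_ /= -pB; apply: le_lt_trans (ple _) _.
  by move: fg; rewrite -ball_normE /ball_ /= cplx_normE ltcR.
have /cvg_ex[a Fa] := comp (@re_part R H) (fun _ _ => erefl) re_part_le.
have /cvg_ex[b Fb] := comp (@im_part R H) (fun _ _ => erefl) im_part_le.
apply/cvg_ex; exists (Cplx a b); apply/cvgrPdist_lt => e e0.
have [r r0 ->] : exists2 r : R, 0 < r & e = r%:C.
  by case: e e0 => r s; rewrite ltcE /= => /andP[/eqP -> ?]; exists r.
have r20 : 0 < r / 2 by rewrite divr_gt0.
move/cvgrPdist_lt : Fa => /(_ _ r20) Fa.
move/cvgrPdist_lt : Fb => /(_ _ r20) Fb.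
near=> f; rewrite cplx_normE ltcR (le_lt_trans (cplx_norm_le _)) //= (splitr r).
by rewrite ltrD //; near: f.
Unshelve. all: by end_near. Qed.

HB.instance Definition _ := Uniform_isComplete.Build HC cplx_complete.

Definition cplx_inner f g : R[i] :=
  (inner (re_part f) (re_part g) + inner (im_part f) (im_part g)) +i*
  (inner (im_part f) (re_part g) - inner (re_part f) (im_part g)).

Lemma cplx_innerDl h : zmod_morphism (cplx_inner^~ h).
Proof.
move: h => [h k] [f g] [f' g']; rewrite /cplx_inner /=.
apply/eqP; rewrite eq_complex /= !linearBl /=; apply/andP; split; apply/eqP; ring.
Qed.

Lemma cplx_innerDr h : zmod_morphism (cplx_inner h).
Proof.
move: h => [h k] [f g] [f' g']; rewrite /cplx_inner /=.
apply/eqP; rewrite eq_complex /= !linearBr /=; apply/andP; split; apply/eqP; ring.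
Qed.

Lemma cplx_innerZl h : scalable_for *%R (cplx_inner^~ h).
Proof.
move: h => [h k] [a b] [f g]; rewrite /cplx_inner /=.
apply/eqP; rewrite eq_complex /= !linearBl !linearDl /= !innerZl.
apply/andP; split; apply/eqP; ring.
Qed.

Lemma cplx_innerZr h : scalable_for (@conjc R \; *%R) (cplx_inner h).
Proof.
move: h => [h k] [a b] [f g]; rewrite /cplx_inner /=.
apply/eqP; rewrite eq_complex /= !linearBr !linearDr /= !innerZr.
apply/andP; split; apply/eqP; ring.
Qed.

HB.instance Definition _ := isBilinear.Build R[i] HC HC R[i] *%R
  (@conjc R \; *%R) cplx_inner cplx_innerDl cplx_innerDr
  cplx_innerZl cplx_innerZr.

Lemma cplx_inner_hermitian f g :
  cplx_inner f g = (-1) ^+ false * (cplx_inner g f)^*.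
Proof.
move: f g => [f f'] [g g'].
rewrite expr0 mul1r /cplx_inner /= (innerC f g) (innerC f' g') (innerC f' g).
rewrite (innerC f g').
by congr (_ +i* _); exact/esym/opprB.
Qed.

HB.instance Definition _ := isHermitianSesquilinear.Build R[i] HC false
  (@conjc R) cplx_inner cplx_inner_hermitian.

Lemma sqr_norm_cplx_inner f : `|f| ^+ 2 = cplx_inner f f.
Proof.
rewrite cplx_normE -rmorphXn /= sqr_cplx_norm /cplx_inner !sqr_norm_inner.
by rewrite (innerC (im_part f)) subrr.
Qed.

Lemma cplx_inner_gt0 f : f != 0 -> 0 < cplx_inner f f.
Proof. by move=> f0; rewrite -sqr_norm_cplx_inner exprn_gt0 // normr_gt0. Qed.

HB.instance Definition _ := isDotProduct.Build R[i] HC cplx_inner cplx_inner_gt0.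

HB.instance Definition _ := isHilbert.Build R[i] (@conjc R) HC
  sqr_norm_cplx_inner.

End ComplexificationAlgebra.

Section Riesz.
Variables (R : realType) (H : realHilbertType R).
Implicit Types x y z : H.

Lemma cauchy_schwarz x y : inner x y <= `|x| * `|y|.
Proof.
have : `|x + y| ^+ 2 <= (`|x| + `|y|) ^+ 2.
  by rewrite lerXn2r ?nnegrE ?addr_ge0 // ler_normD.
rewrite sqr_normD sqrrD; move: (`|x|) (`|y|) (inner x y) => a b c; lra.
Qed.

Lemma riesz (phi : H -> R) :
  (forall x y, phi (x + y) = phi x + phi y) ->
  (forall a x, phi (a *: x) = a * phi x) ->
  (exists M, forall x, phi x <= M * `|x|) ->
  exists z, forall x, phi x = inner x z.
Proof.
move=> phiD phiZ [M0 phiM0].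
pose M := `|M0|; have M_ge0 : 0 <= M by exact: normr_ge0.
have phiM x : phi x <= M * `|x|.
  by rewrite (le_trans (phiM0 x)) // ler_wpM2r // ler_norm.
pose J x := `|x| ^+ 2 - 2 * phi x.
have J_lb x : - M ^+ 2 <= J x.
  have := phiM x; have := sqr_ge0 (`|x| - M); rewrite /J sqrrB.
  move: (phi x) (`|x|) => a b; lra.
have Jinf : has_inf (range J).
  by split; [exists (J 0), 0 | exists (- M ^+ 2) => _ [x _ <-]].
pose m := inf (range J).
have Jm x : m <= J x by apply: ge_inf; [exact: Jinf.2 | exists x].
have JD x y : J (x + y) = J x + `|y| ^+ 2 + 2 * (inner x y - phi y).
  rewrite /J phiD sqr_normD; ring.
have Jdist x y : `|x - y| ^+ 2 <= 2 * (J x - m) + 2 * (J y - m).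
  have := parallelogram x y; have := Jm (2^-1 *: (x + y)).
  rewrite /J phiZ phiD normrZ exprMn ger0_norm ?invr_ge0 //.
  move: (`|x + y|) (`|x - y|) (`|x|) (`|y|) (phi x) (phi y) => a b c d e f.
  have -> : (2^-1 : R) ^+ 2 = 4^-1 by field.
  lra.
pose F := filter_from [set e : R | 0 < e] (fun e => [set x | J x < m + e]).
have FF : ProperFilter F.
  apply: filter_from_proper.
    apply: filter_from_filter; first by exists 1; rewrite /= ltr01.
    move=> a b a0 b0; exists (Num.min a b); first by rewrite /= lt_min a0 b0.
    move=> x /= xab; split; apply: (lt_le_trans xab); rewrite lerD2l.
      by rewrite ge_min lexx.
    by rewrite ge_min lexx orbT.
  move=> e e0; have [_ [x _ <-] xe] := inf_adherent e0 Jinf.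
  by exists x.
have /cvg_ex[z Fz] : cvg F.
  apply: cauchy_cvg; apply/cauchyP => e e0.
  have d0 : 0 < e ^+ 2 / 4 by rewrite divr_gt0 ?exprn_gt0.
  have [_ [x _ <-] xe] := inf_adherent d0 Jinf.
  exists x; exists (e ^+ 2 / 4) => // y /= ye.
  rewrite -ball_normE /ball_ /= -(ltr_pXn2r (ltn0Sn 1)) ?nnegrE ?(ltW e0) //.
  apply: (le_lt_trans (Jdist x y)); rewrite -/m in xe.
  move: (J x) (J y) xe ye => a b; lra.
have Jz : J z <= m.
  apply/ler_addgt0Pr => e e0.
  pose c := 1 + 2 * `|z| + 2 * M.
  have c0 : 0 < c by rewrite /c !ltr_pwDl ?mulr_ge0.
  pose d := e / c; have d0 : 0 < d by rewrite divr_gt0.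
  have /cvgrPdist_lt/(_ _ d0) {}Fz : id @ F --> z by exact: Fz.
  have FJ : F [set x | J x < m + d] by exists d.
  have [x [/= zx Jx]] := filter_ex (filterI Fz FJ).
  have := JD x (z - x); rewrite addrC subrK.
  have -> : inner x (z - x) = inner z (z - x) - `|z - x| ^+ 2.
    by rewrite sqr_norm_inner linearBl /=; ring.
  have := cauchy_schwarz z (z - x); have := phiM (- (z - x)).
  have -> : phi (- (z - x)) = - phi (z - x) by rewrite -scaleN1r phiZ mulN1r.
  have : e = d * (1 + 2 * `|z| + 2 * M) by rewrite /d divfK // gt_eqF.
  have := normr_ge0 z; have := normr_ge0 (z - x).
  rewrite normrN => h1 h2 h3 h4 h5 h6.
  have k1 : M * `|z - x| <= M * d by rewrite ler_wpM2l // ltW.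
  have k2 : `|z| * `|z - x| <= `|z| * d by rewrite ler_wpM2l // ltW.
  have k3 : 0 <= `|z - x| ^+ 2 by rewrite sqr_ge0.
  move: h3 h4 h5 h6 k1 k2 k3 Jx.
  move: (J z) (J x) (inner z (z - x)) (phi (z - x)) => ? ? ? ? *; lra.
exists z => y; rewrite innerC; apply/esym/eqP; rewrite -subr_eq0.
set c := inner z y - phi y.
pose k := `|y| ^+ 2 + 1; have k0 : 0 < k by rewrite ltr_wpDl ?sqr_ge0.
have := JD z ((- c / k) *: y); have := Jm (z + (- c / k) *: y).
rewrite phiZ innerZr -mulrBr -/c normrZ exprMn real_normK ?num_real // => h1 h2.
have {h1 h2} h : 0 <= (- c / k) ^+ 2 * `|y| ^+ 2 + 2 * (- c / k * c) by lra.
have := mulr_ge0 h (sqr_ge0 k).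
have -> : ((- c / k) ^+ 2 * `|y| ^+ 2 + 2 * (- c / k * c)) * k ^+ 2 =
          c ^+ 2 * (`|y| ^+ 2 - 2 * k) by field; rewrite gt_eqF.
rewrite nmulr_lge0; last first.
  by rewrite /k; have := sqr_ge0 `|y|; lra.
by move=> c2; rewrite -sqrf_eq0 eq_le c2 sqr_ge0.
Qed.

Lemma adjointP (A : {linear H -> H}) : bounded_operator A ->
  forall x y, inner (A x) y = inner x (adjoint A y).
Proof.
move=> [M AM] x y; rewrite /adjoint.
suff /getPex : exists z, [set z | forall x, inner (A x) y = inner x z] z.
  exact.
have [|||z zP] := @riesz (fun x => inner (A x) y).
- by move=> a b; rewrite linearD linearDl.
- by move=> a b; rewrite linearZ innerZl.
- exists (M * `|y|) => a; rewrite (le_trans (cauchy_schwarz _ _)) //.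
  by rewrite mulrAC ler_wpM2r.
- by exists z.
Qed.

End Riesz.

(* Main.v *)
(* Put u_n = (e_n + i A e_n) / sqrt 2.  The real and imaginary parts of <u_m, u_n>
   are (<e_m, e_n> + <A e_m, A e_n>) / 2 and (<A e_m, e_n> - <e_m, A e_n>) / 2,
   so orthonormality of (u_n) says that A is symmetric and isometric on the basis,
   which gives A* = A and A^2 = 1.  Conversely, if A = A* and A^2 = 1, the complex
   combinations of the u_n are the vectors (p - A q) + i (A p + q) with p and q
   real combinations of the e_n; every f + i g has this form for some p and q in
   H, and density follows because A is an isometry. *)
Require Import Defs.
From HB Require Import structures.
From mathcomp Require Import all_boot all_order all_algebra.
From mathcomp Require Import all_classical all_reals all_analysis.
From mathcomp Require Import complex ring lra.

Set Implicit Arguments.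
Unset Strict Implicit.
Unset Printing Implicit Defensive.

Import Order.TTheory GRing.Theory Num.Theory.
Import numFieldNormedType.Exports.

Local Open Scope classical_set_scope.
Local Open Scope complex_scope.
Local Open Scope ring_scope.

Lemma denseP (K : numFieldType) (V : normedModType K) (S : set V) :
  dense S <-> forall x (r : K), 0 < r -> exists2 y, S y & `|x - y| < r.
Proof.
split=> [dS x r r0|aS O [x Ox] Oopen].
  have [|y [xy Sy]] := dS (ball x r) _ (ball_open x r).
    by exists x; exact: ballxx.
  by exists y => //; move: xy; rewrite -ball_normE.
have /nbhs_ballP[r /= r0 rO] : nbhs x O by exact: open_nbhs_nbhs.
have [y Sy xy] := aS x r r0.
by exists y; split => //; apply: rO; rewrite -ball_normE.
Qed.

(** Zero padding lets two approximating combinations share one length. *)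
Lemma lin_comb_widen (K : nzRingType) (V : lmodType K) (u : nat -> V)
    (c : nat -> K) (m n : nat) : (m <= n)%N ->
  \sum_(i < m) c i *: u i = \sum_(i < n) (if (i < m)%N then c i else 0) *: u i.
Proof.
move=> mn; rewrite (big_ord_widen _ (fun i => c i *: u i) mn) big_mkcond /=.
by apply: eq_bigr => i _; case: ifP => // _; rewrite scale0r.
Qed.

Section RealHilbert.
Variables (R : realType) (H : realHilbertType R).
Implicit Types x y : H.

Lemma orthonormal_basis_approx (e : nat -> H) (x : H) (r : R) :
  orthonormal_basis e -> 0 < r ->
  exists n (c : nat -> R), `|x - \sum_(i < n) c i *: e i| < r.
Proof.
move=> [_ /denseP e_dense] r0; have [_ [n [c ->]] ?] := e_dense x r r0.
by exists n, c.
Qed.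

Lemma orthonormal_basis_approx2 (e : nat -> H) (x y : H) (r : R) :
  orthonormal_basis e -> 0 < r ->
  exists n (a b : nat -> R), `|x - \sum_(i < n) a i *: e i| < r /\
                             `|y - \sum_(i < n) b i *: e i| < r.
Proof.
move=> e_basis r0; have [m [a xa]] := orthonormal_basis_approx x e_basis r0.
have [n [b yb]] := orthonormal_basis_approx y e_basis r0.
rewrite (lin_comb_widen e a (leq_maxl m n)) in xa.
rewrite (lin_comb_widen e b (leq_maxr m n)) in yb.
exists (maxn m n), (fun i => if (i < m)%N then a i else 0).
by exists (fun i => if (i < n)%N then b i else 0).
Qed.

(** If [x] were nonzero, some finite combination [s] would satisfy |x - s| < |x|. Since <x, s> = 0,
    Cauchy-Schwarz gives |x|^2 = <x, x - s> <= |x| |x - s| < |x|^2. *)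
Lemma orthonormal_basis_eq0 (e : nat -> H) (x : H) : orthonormal_basis e ->
  (forall n, inner x (e n) = 0) -> x = 0.
Proof.
move=> e_basis xe; apply/eqP; apply: contraT => x0.
have nx : 0 < `|x| by rewrite normr_gt0.
have [n [c]] := orthonormal_basis_approx x e_basis nx.
set s := \sum_(i < n) _ => xs.
have xs0 : inner x s = 0.
  by rewrite /s linear_sumr big1 //= => i _; rewrite innerZr xe mulr0.
have : `|x| ^+ 2 <= `|x| * `|x - s|.
  by rewrite sqr_norm_inner -[leLHS]subr0 -xs0 -linearBr /= cauchy_schwarz.
by rewrite expr2 ler_pM2l // leNgt xs.
Qed.

Lemma orthonormal_basis_ext (e : nat -> H) (x y : H) : orthonormal_basis e ->
  (forall n, inner x (e n) = inner y (e n)) -> x = y.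
Proof.
move=> e_basis xy; apply/eqP; rewrite -subr_eq0; apply/eqP.
by apply: (orthonormal_basis_eq0 e_basis) => n; rewrite linearBl /= xy subrr.
Qed.

(** [adjoint A y] is a chosen representing vector; [A y] is one by symmetry, and representing
    vectors are unique. *)
Lemma symmetric_self_adjoint (A : {linear H -> H}) :
  (forall x y, inner (A x) y = inner x (A y)) -> self_adjoint A.
Proof.
move=> A_sym; apply/funext => y; rewrite /adjoint.
have /getPex zP : exists z, [set z | forall x, inner (A x) y = inner x z] z.
  by exists (A y) => x.
set z := get _ in zP *.
have {}zP x : inner (A x) y = inner x z by exact: zP.
apply/eqP; rewrite -subr_eq0 -normr_eq0 -sqrf_eq0.
by rewrite sqr_norm_inner linearBr /= -zP A_sym subrr.
Qed.

(** The adjoint carries the identity from the basis to all of [H] without a limit argument: A* e_k =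
    A e_k, hence <A* x, e_k> = <x, A e_k> = <x, A* e_k> = <A x, e_k>. *)
Lemma symmetric_of_basis (e : nat -> H) (A : {linear H -> H}) :
  orthonormal_basis e -> bounded_operator A ->
  (forall m n, inner (A (e m)) (e n) = inner (e m) (A (e n))) ->
  forall x y, inner (A x) y = inner x (A y).
Proof.
move=> e_basis A_bounded Ae; have adjA := adjointP A_bounded.
have adj_e n : adjoint A (e n) = A (e n).
  by apply: (orthonormal_basis_ext e_basis) => k; rewrite innerC -adjA Ae innerC.
have adjE x : adjoint A x = A x.
  apply: (orthonormal_basis_ext e_basis) => k.
  by rewrite innerC -adjA -adj_e adjA innerC -[RHS]adjA.
by move=> x y; rewrite adjA adjE.
Qed.

(** Test against e_k twice: <A A e_n, e_k> = <A e_n, A e_k> = <e_n, e_k>, then <A A x, e_k> = <x, A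
    A e_k> = <x, e_k>. *)
Lemma involutive_of_basis (e : nat -> H) (A : {linear H -> H}) :
  orthonormal_basis e -> (forall x y, inner (A x) y = inner x (A y)) ->
  (forall m n, inner (A (e m)) (A (e n)) = inner (e m) (e n)) ->
  forall x, A (A x) = x.
Proof.
move=> e_basis A_sym Ae.
have AAe n : A (A (e n)) = e n.
  by apply: (orthonormal_basis_ext e_basis) => k; rewrite A_sym Ae.
by move=> x; apply: (orthonormal_basis_ext e_basis) => k; rewrite !A_sym AAe.
Qed.

(** Trades [adjoint] for pointwise identities: once A* = A, both unitarity equations read A^2 =
    1. *)
Lemma self_adjoint_unitaryP (A : {linear H -> H}) : bounded_operator A ->
  self_adjoint A /\ unitary A <->
  (forall x y, inner (A x) y = inner x (A y)) /\ (forall x, A (A x) = x).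
Proof.
move=> A_bounded; split=> [[Asa [AA _]]|[A_sym AA]].
  split=> [x y|x]; first by rewrite (adjointP A_bounded) Asa.
  by rewrite Asa in AA; exact: (congr1 (@^~ x) AA).
have Asa := symmetric_self_adjoint A_sym.
by split=> //; rewrite /unitary Asa; split; apply/funext.
Qed.

End RealHilbert.

Section GraphSystem.
Variables (R : realType) (H : realHilbertType R).

Lemma CplxD (f g f' g' : H) :
  Cplx f g + Cplx f' g' = Cplx (f + f') (g + g') :> complexification H.
Proof. by []. Qed.

Lemma CplxZ (z : R[i]) (f g : H) :
  z *: (Cplx f g : complexification H) =
  Cplx (complex.Re z *: f - complex.Im z *: g)
       (complex.Re z *: g + complex.Im z *: f).
Proof. by []. Qed.

Definition graph_system (A : H -> H) (e : nat -> H) (n : nat) :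
    complexification H := (1 / Num.sqrt 2)%:C *: Cplx (e n) (A (e n)).

Lemma inner_graph_system (A : H -> H) (e : nat -> H) m n :
  inner (graph_system A e m) (graph_system A e n) =
  ((inner (e m) (e n) + inner (A (e m)) (A (e n))) / 2) +i*
  ((inner (A (e m)) (e n) - inner (e m) (A (e n))) / 2).
Proof.
have sqrt2 : (1 / Num.sqrt 2) ^+ 2 = 2^-1 :> R.
  by rewrite div1r exprVn sqr_sqrtr.
rewrite [LHS]/(cplx_inner _ _) /cplx_inner /=; set k := 1 / _ in sqrt2 *.
rewrite !scale0r !subr0 !addr0 !innerZl !innerZr.
by apply/eqP; rewrite eq_complex /= -sqrt2; apply/andP; split; apply/eqP; ring.
Qed.

(** The factor sqrt 2 in the coefficients cancels the normalisation of [graph_system]; what remains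
    is (a + i b)(e + i A e) summed by linearity. *)
Lemma lin_comb_graph_system (A : {linear H -> H}) (e : nat -> H) n
    (a b : nat -> R) :
  \sum_(i < n) (Num.sqrt 2 * a i +i* (Num.sqrt 2 * b i)) *: graph_system A e i =
  Cplx (\sum_(i < n) a i *: e i - A (\sum_(i < n) b i *: e i))
       (A (\sum_(i < n) a i *: e i) + \sum_(i < n) b i *: e i).
Proof.
elim: n => [|n IHn]; first by rewrite !big_ord0 linear0 subr0 addr0.
have sqrt2 (c : R) : Num.sqrt 2 * c * (1 / Num.sqrt 2) = c.
  by rewrite div1r mulrAC mulfV ?mul1r // gt_eqF.
rewrite !big_ord_recr {}IHn /= /graph_system scalerA !(linearD A) !(linearZZ A).
rewrite CplxZ CplxD /= !mulr0 subr0 add0r !sqrt2.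
by congr Cplx; rewrite /= ?opprD addrACA.
Qed.

End GraphSystem.

Theorem theorem2p12 (R : realType) (H : realHilbertType R)
    (H_separable : separable H)
    (e : nat -> H) (e_basis : orthonormal_basis e)
    (A : {linear H -> H}) (A_bounded : bounded_operator A) :
  (orthonormal_basis
     (fun n => (1 / Num.sqrt 2)%:C *: Cplx (e n) (A (e n))
               : complexification H)
   <-> self_adjoint A /\ unitary A) /\
  (self_adjoint A /\ unitary A ->
   exists2 Ainv : H -> H, inverse_of A Ainv &
     (A : H -> H) = adjoint A /\ adjoint A = Ainv).
Proof.
have saP := self_adjoint_unitaryP A_bounded.
split; last first.
  (* Since A^2 = 1, [A] is its own inverse. *)
  move=> saA; have [_ AA] := saP.1 saA; have [Asa _] := saA.
  by exists A; [split; apply/funext | rewrite Asa].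
have /= e_on := e_basis.1.
rewrite -/(graph_system A e); split=> [[on _]|/saP[A_sym AA]].
  have Ae m n : inner (A (e m)) (A (e n)) = inner (e m) (e n) /\
                inner (A (e m)) (e n) = inner (e m) (A (e n)).
    have := on m n; rewrite inner_graph_system e_on => /eqP.
    rewrite eq_complex raddfMn raddfMn /= mul0rn => /andP[/eqP h1 /eqP h2].
    by split; lra.
  have A_sym := symmetric_of_basis e_basis A_bounded (fun m n => (Ae m n).2).
  apply/saP; split=> //.
  exact: (involutive_of_basis e_basis A_sym (fun m n => (Ae m n).1)).
split=> [m n|].
  rewrite inner_graph_system !A_sym AA e_on subrr mul0r.
  by case: (m == n) => /=; rewrite ?addr0 ?mul0r ?divff ?pnatr_eq0.
have normA x : `|A x| = `|x| by rewrite !norm_sqrt_inner A_sym AA.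
apply/denseP => -[f g] r r0.
(* The radius lives in [R[i]], where being positive forces it to be real. *)
have [d d0 ->] : exists2 d : R, 0 < d & r = d%:C.
  by case: r r0 => r s; rewrite ltcE /= => /andP[/eqP -> ?]; exists r.
(* The real and the imaginary error are each at most |p - p'| + |q - q'|, as [A] is isometric: four
   terms below d / 4. *)
have d4 : 0 < d / 4 by rewrite divr_gt0.
(* With A^2 = 1, the unique solution of p - A q = f and A p + q = g. *)
pose p := 2^-1 *: (f + A g); pose q := 2^-1 *: (g - A f).
have half (x : H) : 2^-1 *: x + 2^-1 *: x = x.
  by rewrite -scalerDl -[RHS]scale1r; congr (_ *: _); field.
have fE : f = p - A q.
  rewrite /p /q linearZ linearB AA -scalerBr opprB addrACA subrr addr0.
  by rewrite scalerDr half.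
have gE : g = A p + q.
  rewrite /p /q linearZ linearD AA -scalerDr addrC addrA subrK.
  by rewrite scalerDr half.
have [N [a [b]]] := orthonormal_basis_approx2 p q e_basis d4.
have abE := lin_comb_graph_system A e N a b.
set p' : H := \sum_(i < N) a i *: e i in abE *.
set q' : H := \sum_(i < N) b i *: e i in abE * => -[pp' qq'].
exists (Cplx (p' - A q') (A p' + q')).
  by exists N, (fun i => Num.sqrt 2 * a i +i* (Num.sqrt 2 * b i)).
rewrite cplx_normE ltcR; apply: le_lt_trans (cplx_norm_le _) _ => /=.
have -> : f - (p' - A q') = (p - p') - A (q - q').
  by rewrite fE (linearB A) !opprB; rewrite [LHS](AC (2*2) ((1*4)*(3*2))).
have -> : g - (A p' + q') = A (p - p') + (q - q').
  by rewrite gE (linearB A) opprD addrACA.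
have := ler_normB (p - p') (A (q - q')).
have := ler_normD (A (p - p')) (q - q').
rewrite !normA; lra.
Qed.
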